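(* Let $0<r\le\frac{\sqrt3}{2}$ and $\beta\in(0,\pi)$. Then a $C_\pi C_{\pi+\beta}$ path (that is, an $L_\pi R_{\pi+\beta}$ path or an $R_\pi L_{\pi+\beta}$ path), starting at any configuration $g_0\in SO(3)$, is non-optimal for the free terminal orientation problem: there is an admissible path of strictly smaller length from $g_0$ to the same final location.
   Context: Dubins vehicle on the unit sphere. Fix $r\in(0,1)$ and put $U_{max}=\frac{\sqrt{1-r^2}}{r}$, so $r=\frac{1}{\sqrt{1+U_{max}^2}}$. A configuration is a rotation matrix $g=(\mathbf X\ \ \mathbf T\ \ \mathbf N)\in SO(3)$ with columns $\mathbf X$ (location on the unit sphere $S^2\subset\mathbb R^3$), $\mathbf T$ (unit tangent, heading) and $\mathbf N=\mathbf X\times\mathbf T$. An admissible path of length $L\ge 0$ starting at $g_0$ is an absolutely continuous curve $g:[0,L]\to SO(3)$, $g(0)=g_0$, satisfying, for some measurable control $u_g:[0,L]\to[-U_{max},U_{max}]$, $$\mathbf X'=\mathbf T,\qquad \mathbf T'=-\mathbf X+u_g\mathbf N,\qquad \mathbf N'=-u_g\mathbf T$$ for almost every $s$. Its final location is $\mathbf X(L)$; in the free terminal orientation problem only the initial configuration and the final location are prescribed, and length is minimized. Segments: an $L$ (left) segment has $u_g\equiv U_{max}$ and an $R$ (right) segment has $u_g\equiv -U_{max}$; an $L$ or $R$ segment of arc angle $\phi$ has length $r\phi$. $C$ denotes either $L$ or $R$; in $CC$ the two segments are of opposite type. Subscripts denote arc angles, and segments are traversed in the order written. *)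

(* Defs.v *)
From HB Require Import structures.
From mathcomp Require Import all_boot all_order all_algebra.
From mathcomp Require Import all_classical all_reals all_analysis.

Set Implicit Arguments.
Unset Strict Implicit.
Unset Printing Implicit Defensive.

Import Order.TTheory GRing.Theory Num.Theory.
Import numFieldNormedType.Exports.

Local Open Scope classical_set_scope.
Local Open Scope ring_scope.

(** Absolute continuity on [[a, b]]; non-overlapping subintervals may share
    endpoints, and degenerate ones ([x i = y i]) contribute nothing. *)
Definition abs_continuous_on (R : realType) (V : normedModType R)
    (a b : R) (f : R -> V) : Prop :=
  forall e : R, 0 < e -> exists2 d : R, 0 < d &
    forall (n : nat) (x y : 'I_n -> R),
      (forall i, a <= x i /\ x i <= y i /\ y i <= b) ->
      trivIset setT (fun i => [set` `]x i, y i[ ]) ->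
      \sum_(i < n) (y i - x i) < d ->
      \sum_(i < n) `|f (y i) - f (x i)| < e.

(** The relation [N = X × T] between the columns of a configuration is part
    of [is_SO3]: it follows from orthonormality and determinant 1. *)
Definition is_SO3 (R : realType) (g : 'M[R]_3) : Prop :=
  g^T *m g = 1%:M /\ \det g = 1.

Definition location (R : realType) (g : 'M[R]_3) : 'cV[R]_3 := col 0 g.
Definition heading (R : realType) (g : 'M[R]_3) : 'cV[R]_3 := col 1 g.
Definition normal (R : realType) (g : 'M[R]_3) : 'cV[R]_3 := col 2 g.

Definition Umax (R : realType) (r : R) : R := Num.sqrt (1 - r ^+ 2) / r.

(** A path of length [L] is a total function [g : R -> 'M[R]_3] of which only
    the restriction to [[0, L]] matters: the two-sided derivatives below are
    constrained almost everywhere, so the two endpoints play no role. *)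
Definition controlled_path (R : realType) (r : R) (g0 : 'M[R]_3) (L : R)
    (u : R -> R) (g : R -> 'M[R]_3) : Prop :=
  [/\ 0 <= L /\ g 0 = g0,
      forall s, s \in `[0, L] -> is_SO3 (g s),
      abs_continuous_on 0 L g,
      measurable_fun [set` `[0, L]] u /\
        (forall s, s \in `[0, L] -> - Umax r <= u s <= Umax r) &
      {ae lebesgue_measure, forall s : R, s \in `[0, L] ->
        [/\ is_derive s 1 (fun t => location (g t)) (heading (g s)),
            is_derive s 1 (fun t => heading (g t))
              (- location (g s) + u s *: normal (g s)) &
            is_derive s 1 (fun t => normal (g t))
              (- (u s *: heading (g s)))]}].

Definition admissible_path (R : realType) (r : R) (g0 : 'M[R]_3) (L : R)
    (g : R -> 'M[R]_3) : Prop :=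
  exists u : R -> R, controlled_path r g0 L u g.

Variant turn := Left | Right.

Definition opposite (c : turn) : turn :=
  match c with Left => Right | Right => Left end.

Definition turn_control (R : realType) (r : R) (c : turn) : R :=
  match c with Left => Umax r | Right => - Umax r end.

(** The control [u] runs a [c]-segment of arc angle [phi], hence of length
    [r * phi], starting at arc length [a]; its values at the two ends of the
    segment are immaterial. *)
Definition turn_segment (R : realType) (r : R) (u : R -> R) (c : turn)
    (a phi : R) : Prop :=
  forall s, s \in `]a, a + r * phi[ -> u s = turn_control r c.

Definition CC_length (R : realType) (r phi1 phi2 : R) : R :=
  r * phi1 + r * phi2.

(** [g] is a [C C] path from [g0] with arc angles [phi1] then [phi2], the first
    segment being of type [c] and the second of the opposite type. *)
Definition CC_path (R : realType) (r : R) (g0 : 'M[R]_3) (c : turn)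
    (phi1 phi2 : R) (g : R -> 'M[R]_3) : Prop :=
  exists u : R -> R,
    [/\ controlled_path r g0 (CC_length r phi1 phi2) u g,
        turn_segment r u c 0 phi1 &
        turn_segment r u (opposite c) (r * phi1) phi2].

(* Main.v *)
(* An [L] or [R] arc multiplies the configuration on the right by a rotation
   about a fixed body axis, so [C_pi C_(pi+beta)] ends on the second circle.
   Reflecting this second circle in the plane through the final location and
   the axis of the first circle gives another circle tangent to the first one,
   hence a path [C_(pi-2d) C_(pi-beta)] with the same final location, where [d]
   is the azimuth of the final location measured from the tangency point. The
   condition [r ^+ 2 <= 3 / 4] is what makes [d < pi / 2], so the new angles are
   nonnegative and the new path is shorter. A path with a.e. prescribed controls
   is determined by its start because an absolutely continuous function with
   zero derivative almost everywhere is constant. *)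
Require Import Defs.
From HB Require Import structures.
From mathcomp Require Import all_boot all_order all_algebra.
From mathcomp Require Import ring lra.
From mathcomp Require Import all_classical all_reals all_analysis.
From mathcomp Require Import measurable_realfun.

Set Implicit Arguments.
Unset Strict Implicit.
Unset Printing Implicit Defensive.

Import Order.TTheory GRing.Theory Num.Theory.
Import numFieldNormedType.Exports.

Local Open Scope ring_scope.

(** * Absolute continuity: list form and domination criterion *)

(** Lists run from right to left, so a covering argument moving rightwards can add each new interval
    at the head. *)
Lemma abs_continuous_seq (R : realType) (V : normedModType R) (a b : R)
    (f : R -> V) :
  abs_continuous_on a b f ->
  forall e : R, 0 < e -> exists2 d : R, 0 < d &
    forall s : seq (R * R),
      {in s, forall u, [/\ a <= u.1, u.1 <= u.2 & u.2 <= b]} ->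
      pairwise (fun u v => v.2 <= u.1) s ->
      \sum_(u <- s) (u.2 - u.1) < d ->
      \sum_(u <- s) `|f u.2 - f u.1| < e.
Proof.
move=> acf e /acf[d d0 fd]; exists d => // s sab /(pairwiseP (0, 0)) sP.
rewrite !(big_nth (0, 0)) !big_mkord; apply: fd => [i|i j _ _ [t /=]].
  by have [] := sab _ (mem_nth (0, 0) (ltn_ord i)).
rewrite !in_itv/= => -[/andP[xi iy] /andP[xj jy]]; apply/val_inj => /=.
have [ij|ji|//] := ltngtP i j.
- have := sP i j (ltn_ord i) (ltn_ord j) ij.
  by rewrite leNgt (lt_trans xi jy).
- have := sP j i (ltn_ord j) (ltn_ord i) ji.
  by rewrite leNgt (lt_trans xj iy).
Qed.

(** Two dominating functions are what a product needs; for transposes, entries and Lipschitz maps a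
    single one is passed twice. *)
Lemma abs_continuous_dominated (R : realType) (V W X : normedModType R)
    (a b C : R) (f : R -> V) (g : R -> W) (h : R -> X) :
  abs_continuous_on a b f -> abs_continuous_on a b g ->
  (forall x y, a <= x -> x <= y -> y <= b ->
    `|h y - h x| <= C * (`|f y - f x| + `|g y - g x|)) ->
  abs_continuous_on a b h.
Proof.
move=> acf acg hC e e0; pose D := `|C| + 1.
have D0 : 0 < D by rewrite ltr_wpDl.
have e1 : 0 < e / D / 2 by rewrite !divr_gt0.
have [d1 d10 fd] := acf _ e1; have [d2 d20 gd] := acg _ e1.
exists (Num.min d1 d2) => [|n x y xy txy]; first by rewrite lt_min d10.
rewrite lt_min => /andP[/(fd _ _ _ xy txy) ltf /(gd _ _ _ xy txy) ltg].
apply: (@le_lt_trans _ _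
  (D * (\sum_(i < n) `|f (y i) - f (x i)| + \sum_(i < n) `|g (y i) - g (x i)|))).
  rewrite -big_split mulr_sumr /=; apply: ler_sum => i _.
  have [ax [xyi yb]] := xy i.
  apply: le_trans (hC _ _ ax xyi yb) _; apply: ler_wpM2r; first exact: addr_ge0.
  by rewrite (le_trans (ler_norm _))// lerDl.
by rewrite mulrC -ltr_pdivlMr// (splitr (e / D)) ltrD.
Qed.

Lemma lipschitz_abs_continuous (R : realType) (V : normedModType R)
    (a b C : R) (f : R -> V) :
  (forall x y, x <= y -> `|f y - f x| <= C * (y - x)) ->
  abs_continuous_on a b f.
Proof.
move=> fC; have acid : abs_continuous_on a b (@idfun R).
  move=> e e0; exists e => // n x y xy _.
  rewrite [X in _ -> X < e](eq_bigr (fun i => y i - x i))//.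
  by move=> i _ /=; rewrite ger0_norm// subr_ge0; have [_ []] := xy i.
apply: (abs_continuous_dominated (C := `|C|) acid acid) => x y _ xy _ /=.
have yx : 0 <= y - x by rewrite subr_ge0.
apply: le_trans (fC _ _ xy) _; rewrite (ger0_norm yx).
by rewrite (le_trans (ler_wpM2r yx (ler_norm C)))// ler_wpM2l// lerDl.
Qed.

(** * Zero derivative almost everywhere implies constancy *)

Lemma is_derive_small (R : realType) (f : R -> R) (s e : R) :
  is_derive s 1 f 0 -> 0 < e ->
  exists2 n : R, 0 < n &
    forall t, `|t - s| < n -> `|f t - f s| <= e * `|t - s|.
Proof.
move=> [df df0] e0.
have : (h^-1 *: ((f \o shift s) (h *: (1 : R)) - f s) @[h --> 0^']
  --> 'D_1 f s)%classic by exact: df.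
rewrite df0 => /cvgrPdist_le/(_ _ e0)[n /= n0 nP]; exists n => // t tn.
have [->|ts] := eqVneq t s; first by rewrite !subrr normr0 mulr0.
have ts0 : t - s != 0 by rewrite subr_eq0.
have := nP (t - s); rewrite /= sub0r normrN => /(_ tn ts0).
rewrite sub0r normrN /= scaler1 subrK normrZ normfV mulrC.
by rewrite ler_pdivrMr// normr_gt0.
Qed.

(** Induction on the list: the head is the rightmost interval, and the tail lies in the part of [U]
    left of [p], disjoint from []p, q]]. The half-open form avoids counting a shared endpoint
    twice. *)
Lemma sum_length_le_measure (R : realType) (U : set R) (s : seq (R * R)) :
  measurable U ->
  {in s, forall u, u.1 <= u.2 /\ (`[u.1, u.2] `<=` U)%classic} ->
  pairwise (fun u v => v.2 <= u.1) s ->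
  ((\sum_(u <- s) (u.2 - u.1))%:E <= lebesgue_measure U)%E.
Proof.
move=> mU; elim: s U mU => [|[p q] s IHs] U mU sU; first by rewrite big_nil.
rewrite pairwise_cons => /andP[/allP /= sp sP]; rewrite big_cons /= EFinD.
have [/= pq pqU] := sU _ (mem_head _ _).
have mUp : measurable (U `&` `]-oo, p])%classic.
  by apply: measurableI => //; exact: measurable_itv.
have dis : ((U `&` `]-oo, p]) `&` `]p, q] = set0)%classic.
  rewrite -setIA -subset0 => t [_ [/=]]; rewrite !in_itv /= => tp /andP[pt _].
  by rewrite leNgt pt in tp.
have -> : (q - p)%:E = lebesgue_measure [set` `]p, q]].
  rewrite lebesgue_measure_itv/= lte_fin.
  have [//|] := ltP p q; move=> qp; suff -> : q = p by rewrite subrr.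
  by apply/eqP; rewrite eq_le qp pq.
apply: (@le_trans _ _ (lebesgue_measure [set` `]p, q]] +
    lebesgue_measure (U `&` `]-oo, p])%classic))%E.
  apply: leeD2l; apply: IHs => // u us.
  have [u12 uU] := sU _ (@mem_behead _ ((p, q) :: s) _ us).
  split => // t /[dup] /uU tU /=.
  rewrite !in_itv/= => /andP[_ tu]; split => //=.
  exact: le_trans tu (sp _ us).
rewrite addeC -measureU//; apply: le_measure; rewrite ?inE//.
  exact: measurableU.
move=> t [[]//|]; rewrite /= in_itv/= => /andP[pt tq].
by apply: pqU; rewrite /= in_itv/= (ltW pt).
Qed.

(* Every point [c] of [[a, b]] either lies in a small open set [U] covering the
   exceptional null set, or [f] has slope at most [e] around it. Advancing by a
   supremum argument, the increment of [f] is at most [e * (b - a)] plus its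
   increments over disjoint intervals inside [U], which absolute continuity
   bounds by [e]. *)
Lemma abs_continuous_derive0 (R : realType) (a b : R) (f : R -> R) :
  a <= b -> abs_continuous_on a b f ->
  {ae lebesgue_measure, forall s : R, s \in `[a, b] -> is_derive s 1 f 0} ->
  f b = f a.
Proof.
move=> ab acf [A [mA A0 NA]]; apply/eqP; rewrite -subr_eq0 -normr_le0.
apply/ler_addgt0Pl => e' e'0; rewrite addr0.
(* One [e] pays for the intervals inside [U] and [e * (b - a)] for the points of small slope;
   together they make [e']. *)
pose e := e' / (1 + (b - a)).
have ba0 : 0 < 1 + (b - a) by rewrite ltr_pwDl// subr_ge0.
have e0 : 0 < e by rewrite divr_gt0.
have [d d0 fd] := abs_continuous_seq acf e0.
have muA : lebesgue_measure A = 0%E by exact: A0.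
have [U [oU AU UA]] : exists U : set R, [/\ open U, (A `<=` U)%classic &
    (lebesgue_measure (U `\` A)%classic < d%:E)%E].
  by apply: lebesgue_regularity_outer => //; rewrite [ltLHS]muA ltry.
have mU : measurable U by exact: open_measurable.
have muU : (lebesgue_measure U < d%:E)%E.
  rewrite -(setDUK AU) measureU//; last by exact: setDIK.
    by rewrite [X in (X + _)%E]muA add0e.
  exact: measurableD.
(* The invariant carried from [a] to [b]: up to [x], the increment of [f] splits into a part over
   intervals inside [U] and a part of slope at most [e]. *)
pose P x := exists s : seq (R * R),
  [/\ {in s, forall u, [/\ a <= u.1, u.1 <= u.2 & u.2 <= x]},
      {in s, forall u, (`[u.1, u.2] `<=` U)%classic},
      pairwise (fun u v => v.2 <= u.1) s &
      `|f x - f a| <= \sum_(u <- s) `|f u.2 - f u.1| + e * (x - a)].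
have Pa : P a.
  by exists [::]; split=> //; rewrite big_nil !subrr normr0 mulr0 addr0.
have extend p q : a <= p -> p <= q -> P p ->
    (`[p, q] `<=` U)%classic \/ `|f q - f p| <= e * (q - p) -> P q.
  move=> ap pq [s [sp sU sP fp]].
  have fqp : `|f q - f a| <= `|f q - f p| + `|f p - f a|.
    by rewrite -[X in `|X|](subrKA (f p)) (le_trans _ (ler_normD _ _)).
  have fq : `|f q - f a| <= `|f q - f p| +
      (\sum_(u <- s) `|f u.2 - f u.1| + e * (p - a)).
    by apply: le_trans fqp _; rewrite lerD2l.
  move=> [pqU|fe].
    exists ((p, q) :: s); split.
    - move=> u /[!inE]/orP[/eqP ->//|/sp[au u12 up]]; split => //.
      exact: le_trans pq.
    - by move=> u /[!inE]/orP[/eqP ->//|/sU].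
    - by rewrite pairwise_cons sP andbT; apply/allP => u /sp[].
    - rewrite big_cons/= -addrA (le_trans fq)// !lerD2l ler_wpM2l ?(ltW e0)//.
      by rewrite lerD2r.
  exists s; split => //.
    by move=> u /sp[au u12 up]; split => //; exact: le_trans pq.
  rewrite (le_trans fq)//; move: fe; set S := \sum_(u <- s) _; lra.
have local c : c \in `[a, b] -> exists2 n : R, 0 < n & forall p q,
    c - n < p -> p <= c -> c <= q -> q < c + n ->
    (`[p, q] `<=` U)%classic \/ `|f q - f p| <= e * (q - p).
  move=> cab; have [Uc|nUc] := pselect (U c).
    have /nbhs_ballP[n /= n0 nU] := open_nbhs_nbhs (conj oU Uc).
    exists n => // p q cp pc cq qc; left => t /=.
    rewrite in_itv/= => /andP[pt tq].
    apply: nU; rewrite /ball/= ltr_norml; apply/andP; split; lra.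
  have fc : is_derive c 1 f 0.
    apply: contrapT => nfc; apply: nUc; apply: AU; apply: NA => /= /(_ cab).
    exact: nfc.
  have [n n0 nf] := is_derive_small fc e0.
  exists n => // p q cp pc cq qc; right.
  have fq : `|f q - f c| <= e * (q - c).
    rewrite -[q - c]ger0_norm ?subr_ge0//; apply: nf.
    by rewrite ltr_norml; apply/andP; split; lra.
  have fp : `|f c - f p| <= e * (c - p).
    rewrite -[c - p]ger0_norm ?subr_ge0// distrC (distrC c); apply: nf.
    by rewrite ltr_norml; apply/andP; split; lra.
  rewrite -[X in `|X|](subrKA (f c)) (le_trans (ler_normD _ _))//.
  lra.
have Pb : P b.
  pose S := [set x | a <= x <= b /\ P x]%classic.
  have Sa : S a by split => //; rewrite lexx.
  have hS : has_sup S.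
    by split; [exists a | exists b => x [/andP[]]].
  set c := sup S.
  have ac : a <= c by apply: sup_upper_bound.
  have cb : c <= b by apply: ge_sup => [|x [/andP[]]//]; exists a.
  have [|n n0 nP] := local c; first by rewrite in_itv/= ac.
  have [p [/andP[ap pb] Pp] cp] := sup_adherent n0 hS.
  have pc : p <= c by apply: sup_upper_bound => //; split => //; rewrite ap.
  (* [P] holds at some [p] within [n] of the supremum [c], hence passes across [c] to [q]; unless
     [q] is [b], this contradicts the choice of [c]. *)
  pose q := Num.min b (c + n / 2).
  have cq : c <= q by rewrite le_min cb/=; lra.
  have qc : q < c + n by rewrite gt_min; apply/orP; right; lra.
  have Pq : P q.
    by apply: extend Pp (nP _ _ cp pc cq qc) => //; exact: le_trans cq.
  have [bc|cb'] := leP b (c + n / 2); first by move: Pq; rewrite /q min_l.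
  have : c + n / 2 <= c.
    apply: sup_upper_bound => //; split; first by apply/andP; split; lra.
    by move: Pq; rewrite /q min_r// ltW.
  lra.
have [s [sb sU sP fb]] := Pb.
have sd : \sum_(u <- s) (u.2 - u.1) < d.
  rewrite -lte_fin; apply: le_lt_trans muU; apply: sum_length_le_measure => //.
  by move=> u us; split; [case: (sb _ us) | exact: sU].
have := fd s sb sP sd; have ee : e * (1 + (b - a)) = e'.
  by rewrite /e divfK// gt_eqF.
by move: fb; set S := \sum_(u <- s) _; lra.
Qed.

(** * Derivatives and sup norms of matrices *)

Lemma is_derive_mxP (R : realType) (V : normedModType R) (m n : nat)
    (M : V -> 'M[R]_(m, n)) (t v : V) (dM : 'M[R]_(m, n)) :
  is_derive t v M dM <-> forall i j, is_derive t v (fun x => M x i j) (dM i j).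
Proof.
split=> [[Mtv <-] i j|MP].
  apply: DeriveDef; first exact: (derivable_mxP M t v).1.
  by rewrite derive_mx// mxE.
have Mtv : derivable M t v.
  by apply: (derivable_mxP M t v).2 => i j; have [] := MP i j.
apply: DeriveDef => //; rewrite derive_mx//; apply/matrixP => i j.
by rewrite mxE; have [] := MP i j.
Qed.

Lemma is_derive_mulmx (R : realType) (m n p : nat) (A : R -> 'M[R]_(m, n))
    (B : R -> 'M[R]_(n, p)) (s : R) dA dB :
  is_derive s 1 A dA -> is_derive s 1 B dB ->
  is_derive s 1 (fun t => A t *m B t) (dA *m B s + A s *m dB).
Proof.
move=> /is_derive_mxP dAP /is_derive_mxP dBP; apply/is_derive_mxP => i j.
rewrite (_ : (fun x => _) =
    \sum_(k < n) ((fun x => A x i k) * (fun x => B x k j))); last first.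
  by apply/funext => x; rewrite mxE fct_sumE.
have dk k := is_deriveM (dAP i k) (dBP k j).
apply: is_derive_eq (is_derive_sum dk) _.
rewrite !mxE -big_split; apply: eq_bigr => k _ /=.
by rewrite addrC /GRing.scale/=; congr (_ + _); rewrite mulrC.
Qed.

Lemma is_derive_trmx (R : realType) (m n : nat) (A : R -> 'M[R]_(m, n))
    (s : R) dA :
  is_derive s 1 A dA -> is_derive s 1 (fun t => (A t)^T) dA^T.
Proof.
move=> /is_derive_mxP dAP; apply/is_derive_mxP => i j; rewrite mxE.
rewrite (_ : (fun x => _) = (fun x => A x j i))//.
by apply/funext => x; rewrite mxE.
Qed.

Lemma coef_le_mx_norm (R : realType) (m n : nat) (A : 'M[R]_(m, n)) i j :
  `|A i j| <= `|A|.
Proof.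
rewrite [leRHS]/Num.Def.normr/= mx_normrE.
exact: (le_bigmax _ (fun ij => `|A ij.1 ij.2|) (i, j)).
Qed.

Lemma mx_norm_le (R : realType) (m n : nat) (A : 'M[R]_(m, n)) (C : R) :
  0 <= C -> (forall i j, `|A i j| <= C) -> `|A| <= C.
Proof.
by move=> C0 AC; rewrite [leLHS]/Num.Def.normr/= mx_normrE bigmax_le.
Qed.

Lemma mx_norm_mulmx (R : realType) (m n p : nat) (A : 'M[R]_(m, n))
    (B : 'M[R]_(n, p)) : `|A *m B| <= n%:R * (`|A| * `|B|).
Proof.
apply: mx_norm_le => [|i j]; first by rewrite !mulr_ge0.
rewrite mxE (le_trans (ler_norm_sum _ _ _))//.
rewrite mulr_natl -[X in _ *+ X]card_ord -sumr_const; apply: ler_sum => k _.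
by rewrite normrM ler_pM// coef_le_mx_norm.
Qed.

Lemma mx_norm_tr (R : realType) (m n : nat) (A : 'M[R]_(m, n)) : `|A^T| = `|A|.
Proof.
apply/eqP; rewrite eq_le; apply/andP; split; apply: mx_norm_le => // i j.
  by rewrite mxE coef_le_mx_norm.
by rewrite -[A i j](mxE trmx_key (fun j i => A i j)) coef_le_mx_norm.
Qed.

(** * The frame equation and its constant-control solutions *)

(** The three column equations become the single left-invariant equation [g' = g *m frame_gen u] on
    the rotation group. *)
Definition frame_gen (R : realType) (u : R) : 'M[R]_3 :=
  \matrix_(i < 3, j < 3) nth 0 (nth [::]
    [:: [:: 0; -1; 0]; [:: 1; 0; -u]; [:: 0; u; 0]] i) j.

Lemma frame_derivP (R : realType) (g : R -> 'M[R]_3) (s u : R) :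
  is_derive s 1 g (g s *m frame_gen u) <->
  [/\ is_derive s 1 (fun t => location (g t)) (heading (g s)),
      is_derive s 1 (fun t => heading (g t))
        (- location (g s) + u *: normal (g s)) &
      is_derive s 1 (fun t => normal (g t)) (- (u *: heading (g s)))].
Proof.
have colE (k : 'I_3) : forall i j,
    (fun t => col k (g t) i j) = (fun t => g t i k).
  by move=> i j; apply/funext => t; rewrite mxE.
have genE i : [/\ (g s *m frame_gen u) i 0 = g s i 1,
    (g s *m frame_gen u) i 1 = - g s i 0 + u * g s i 2 &
    (g s *m frame_gen u) i 2 = - (u * g s i 1)].
  rewrite !mxE !big_ord_recl !big_ord0 !mxE /=.
  have -> : lift ord0 ord0 = 1 :> 'I_3 by apply/val_inj.
  have -> : lift ord0 (lift ord0 ord0) = 2 :> 'I_3 by apply/val_inj.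
  by split; ring.
split=> [/is_derive_mxP dg|[/is_derive_mxP dX /is_derive_mxP dT /is_derive_mxP dN]].
  split; apply/is_derive_mxP => i j; rewrite colE !mxE.
  - by have [<- _ _] := genE i.
  - by have [_ <- _] := genE i.
  - by have [_ _ <-] := genE i.
apply/is_derive_mxP => i j; have [g0E g1E g2E] := genE i.
case: j => [[|[|[|//]]] jp].
- rewrite (_ : Ordinal jp = 0); last exact/val_inj.
  by rewrite g0E; have := dX i 0; rewrite colE !mxE.
- rewrite (_ : Ordinal jp = 1); last exact/val_inj.
  by rewrite g1E; have := dT i 0; rewrite colE !mxE.
- rewrite (_ : Ordinal jp = 2); last exact/val_inj.
  by rewrite g2E; have := dN i 0; rewrite colE !mxE.
Qed.

Lemma frame_gen_tr (R : realType) (u : R) : (frame_gen u)^T = - frame_gen u.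
Proof.
apply/matrixP => i j; case: i => [[|[|[|//]]] ip]; case: j => [[|[|[|//]]] jp];
  by rewrite !mxE /= ?oppr0 ?opprK.
Qed.

(* Rodrigues' formula: [r *: frame_gen v] is the infinitesimal rotation about
   the unit body vector [(r v, 0, r)] when [r ^+ 2 * (1 + v ^+ 2) = 1]. *)
Definition frame_rot (R : realType) (r v th : R) : 'M[R]_3 :=
  1%:M + sin th *: (r *: frame_gen v) +
  (1 - cos th) *: (r *: frame_gen v *m (r *: frame_gen v)).

(** This is Cayley-Hamilton for a skew matrix with unit axis: products of rotations stay in the span
    of [1], [J] and [J *m J]. *)
Lemma frame_gen_cube (R : realType) (r v : R) :
  r ^+ 2 * (1 + v ^+ 2) = 1 ->
  r *: frame_gen v *m (r *: frame_gen v *m (r *: frame_gen v)) =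
  - (r *: frame_gen v).
Proof.
move=> rv; have key : frame_gen v *m (frame_gen v *m frame_gen v) =
    (- (1 + v ^+ 2)) *: frame_gen v.
  apply/matrixP => i j; case: i => [[|[|[|//]]] ip]; case: j => [[|[|[|//]]] jp];
  rewrite !mxE !big_ord_recl !big_ord0 !mxE /= !big_ord_recl !big_ord0 !mxE /=;
  by ring.
rewrite -!scalemxAl -!scalemxAr key !scalerA -scaleNr; congr (_ *: _).
transitivity (- (r * (r ^+ 2 * (1 + v ^+ 2)))); first by ring.
by rewrite rv mulr1.
Qed.

Lemma frame_rotD (R : realType) (r v a b : R) :
  r ^+ 2 * (1 + v ^+ 2) = 1 ->
  frame_rot r v (a + b) = frame_rot r v a *m frame_rot r v b.
Proof.
move=> /frame_gen_cube; rewrite /frame_rot; move: (r *: frame_gen v) => J.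
(* Hiding the square behind [K] makes its entries atoms for [ring]; only the products of [J] and [K]
   matter. *)
have [K KE] : exists K, K = J *m J by exists (J *m J).
rewrite -!KE => JK; have KJ : K *m J = - J by rewrite {1}KE -mulmxA -KE.
have KK : K *m K = - K by rewrite {1}KE -mulmxA JK mulmxN -KE.
rewrite cosD sinD !mulmxDl !mulmxDr !mul1mx !mulmx1 -!scalemxAl -!scalemxAr.
rewrite JK KJ KK -KE; apply/matrixP => i j.
by rewrite !mxE; ring.
Qed.

Lemma frame_rot0 (R : realType) (r v : R) : frame_rot r v 0 = 1%:M.
Proof. by rewrite /frame_rot sin0 cos0 subrr !scale0r !addr0. Qed.

Lemma frame_rot_tr (R : realType) (r v th : R) :
  (frame_rot r v th)^T = frame_rot r v (- th).
Proof.
have : (r *: frame_gen v)^T = - (r *: frame_gen v).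
  by rewrite linearZ/= frame_gen_tr scalerN.
rewrite /frame_rot; move: (r *: frame_gen v) => J Jt.
rewrite !linearD/= !linearZ/= trmx1 trmx_mul Jt sinN cosN.
by rewrite mulmxN mulNmx opprK scalerN scaleNr.
Qed.

Lemma is_SO3_mul (R : realType) (g h : 'M[R]_3) :
  is_SO3 g -> is_SO3 h -> is_SO3 (g *m h).
Proof.
move=> [gg dg] [hh dh]; split; last by rewrite det_mulmx dg dh mulr1.
by rewrite trmx_mul mulmxA -(mulmxA h^T) gg mulmx1.
Qed.

Lemma is_SO3_frame_rot (R : realType) (r v th : R) :
  r ^+ 2 * (1 + v ^+ 2) = 1 -> is_SO3 (frame_rot r v th).
Proof.
move=> rv; have orth x : (frame_rot r v x)^T *m frame_rot r v x = 1%:M.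
  by rewrite frame_rot_tr -frame_rotD// addNr frame_rot0.
(* The determinant is the square of that of the half-angle rotation, and orthogonality makes this
   square 1. *)
split => //; rewrite [th]splitr frame_rotD// det_mulmx -expr2.
by have /(congr1 determinant) := orth (th / 2); rewrite det_mulmx det_tr det1.
Qed.

Lemma is_SO3_norm_le1 (R : realType) (g : 'M[R]_3) : is_SO3 g -> `|g| <= 1.
Proof.
move=> [gg _]; apply: mx_norm_le => // i j.
have := congr1 (fun A : 'M[R]_3 => A j j) gg.
rewrite !mxE eqxx mulr1n (bigD1 i)//= mxE => g1.
rewrite -(@expr_le1 _ 2)// real_normK ?num_real// -g1 expr2 lerDl sumr_ge0// => k _.
by rewrite mxE -expr2 sqr_ge0.
Qed.

Lemma is_derive_frame_rot (R : realType) (r v m s : R) :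
  r != 0 -> r ^+ 2 * (1 + v ^+ 2) = 1 ->
  is_derive s 1 (fun t => frame_rot r v ((t - m) / r))
    (frame_rot r v ((s - m) / r) *m frame_gen v).
Proof.
move=> r0 /frame_gen_cube; rewrite /frame_rot.
have vE : frame_gen v = r^-1 *: (r *: frame_gen v).
  by rewrite scalerA mulVf// scale1r.
rewrite [X in is_derive _ _ _ (_ *m X)]vE; move: (r *: frame_gen v) => J {vE}.
have [K KE] : exists K, K = J *m J by exists (J *m J).
rewrite -!KE => JK; have KJ : K *m J = - J by rewrite {1}KE -mulmxA -KE.
rewrite -scalemxAr !mulmxDl mul1mx -!scalemxAl KJ -KE.
apply/is_derive_mxP => i j.
rewrite (_ : (fun x => _) = (fun x => (1%:M : 'M[R]_3) i j +
    sin ((x - m) / r) * J i j + (1 - cos ((x - m) / r)) * K i j)); last first.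
  by apply/funext => x; rewrite !mxE.
apply: is_derive_eq; rewrite !mxE.
by rewrite /GRing.scale/=; ring.
Qed.

(** * Lipschitz bounds, products of rotations and uniqueness of paths *)

(** The mean value theorem applies to each entry separately, and the sup norm keeps the same
    constant. *)
Lemma mx_norm_lipschitz (R : realType) (m n : nat) (A dA : R -> 'M[R]_(m, n))
    (C x y : R) :
  0 <= C -> (forall t : R, is_derive t 1 A (dA t)) -> (forall t, `|dA t| <= C) ->
  x <= y -> `|A y - A x| <= C * (y - x).
Proof.
move=> C0 AdA dAC xy; have yx : 0 <= y - x by rewrite subr_ge0.
apply: mx_norm_le => [|i j]; first exact: mulr_ge0.
have Aij (t : R) : is_derive t 1 (fun t => A t i j) (dA t i j).
  by have /is_derive_mxP := AdA t; apply.
have cA : {within `[x, y], continuous (fun t => A t i j)}%classic.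
  by apply: derivable_within_continuous => t _; have [] := Aij t.
have [t _ E] := MVT_segment xy (fun t _ => Aij t) cA.
rewrite !mxE E normrM (ger0_norm yx) ler_wpM2r//.
exact: le_trans (coef_le_mx_norm _ _ _) (dAC t).
Qed.

Lemma is_SO3_mulmx_abs_continuous (R : realType) (a b : R)
    (f g : R -> 'M[R]_3) :
  (forall s, s \in `[a, b] -> is_SO3 (f s)) ->
  (forall s, s \in `[a, b] -> is_SO3 (g s)) ->
  abs_continuous_on a b f -> abs_continuous_on a b g ->
  abs_continuous_on a b (fun s => f s *m g s).
Proof.
move=> fSO gSO acf acg.
(* The constant 3 is the dimension factor in [mx_norm_mulmx]; rotations themselves have norm at most
   1. *)
apply: (abs_continuous_dominated (C := 3) acf acg) => x y ax xy yb.
have -> : f y *m g y - f x *m g x = (f y - f x) *m g x + f y *m (g y - g x).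
  by rewrite [RHS]addrC mulmxBl mulmxBr subrKA.
have f1 : `|f y| <= 1.
  by apply/is_SO3_norm_le1/fSO; rewrite in_itv/= yb andbT (le_trans ax).
have g1 : `|g x| <= 1.
  by apply/is_SO3_norm_le1/gSO; rewrite in_itv/= ax (le_trans xy).
apply: le_trans (ler_normD _ _) _; rewrite mulrDr lerD//.
  by rewrite (le_trans (mx_norm_mulmx _ _))// ler_wpM2l// ler_piMr.
by rewrite (le_trans (mx_norm_mulmx _ _))// ler_wpM2l// ler_piMl.
Qed.

Lemma is_SO3_tr (R : realType) (g : 'M[R]_3) : is_SO3 g -> is_SO3 g^T.
Proof. by move=> [gg dg]; split; rewrite ?det_tr// trmxK (mulmx1C gg). Qed.

(* With skew-symmetric generators, [g *m g'^T] has zero derivative. *)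
Lemma controlled_path_uniq (R : realType) (r L : R) (g0 : 'M[R]_3)
    (u u' : R -> R) (g g' : R -> 'M[R]_3) :
  controlled_path r g0 L u g -> controlled_path r g0 L u' g' ->
  {ae lebesgue_measure, forall s : R, s \in `[0, L] -> u s = u' s} ->
  g L = g' L.
Proof.
move=> [[L0 g00] gSO acg _ dg] [[_ g'00] g'SO acg' _ dg'] uu'.
have g'trSO s : s \in `[0, L] -> is_SO3 (g' s)^T by move=> /g'SO/is_SO3_tr.
have actr : abs_continuous_on 0 L (fun s => (g' s)^T).
  apply: (abs_continuous_dominated (C := 1) acg' acg') => x y _ _ _.
  by rewrite -linearB/= mx_norm_tr mul1r lerDl.
have acM := is_SO3_mulmx_abs_continuous gSO g'trSO acg actr.
have dM : {ae lebesgue_measure, forall s : R, s \in `[0, L] ->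
    is_derive s 1 (fun t => g t *m (g' t)^T) 0}.
  apply: (filterS3 (ae_filter_ringOfSetsType _) _ dg dg' uu').
  move=> s {}dg {}dg' {}uu' sL.
  have /frame_derivP gd := dg sL; have /frame_derivP g'd := dg' sL.
  apply: is_derive_eq (is_derive_mulmx gd (is_derive_trmx g'd)) _.
  by rewrite trmx_mul frame_gen_tr -mulmxA -mulmxDr uu'// mulNmx subrr mulmx0.
have MLE : g L *m (g' L)^T = g 0 *m (g' 0)^T.
  apply/matrixP => i j.
  apply: (@abs_continuous_derive0 _ 0 L (fun s => (g s *m (g' s)^T) i j)) => //.
    apply: (abs_continuous_dominated (C := 1) acM acM) => x y _ _ _.
    apply: (@le_trans _ _ `|g y *m (g' y)^T - g x *m (g' x)^T|).
      apply: le_trans (coef_le_mx_norm _ i j).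
      by rewrite [X in _ <= `|X|]mxE [X in _ <= `|_ + X|]mxE.
    by rewrite mul1r lerDl.
  apply: (@filterS _ _ (ae_filter_ringOfSetsType _) _ _ _ dM) => s {}dM.
  by move=> /dM/is_derive_mxP/(_ i j); rewrite mxE.
have /g'SO[g'L _] : L \in `[0, L] by rewrite in_itv/= L0 lexx.
have /g'SO[g'0 _] : 0 \in `[0, L] by rewrite in_itv/= L0 lexx.
rewrite g00 -g'00 (mulmx1C g'0) in MLE.
by rewrite -[LHS]mulmx1 -g'L mulmxA MLE mul1mx.
Qed.

(** * Two-arc paths and their endpoints *)

(** Clamping by [min] and [max] freezes the first rotation after [m] and keeps the second one
    trivial before [m]. The path is thus a product of Lipschitz factors, with no gluing at the
    joint. *)
Definition two_arcs (R : realType) (r v : R) (g0 : 'M[R]_3) (m s : R) :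
  'M[R]_3 :=
  g0 *m frame_rot r v (Num.min s m / r) *m frame_rot r (- v) ((Num.max s m - m) / r).

Lemma frame_rot_lipschitz (R : realType) (r v m x y : R) :
  r != 0 -> r ^+ 2 * (1 + v ^+ 2) = 1 -> x <= y ->
  `|frame_rot r v ((y - m) / r) - frame_rot r v ((x - m) / r)| <=
  3 * `|frame_gen v| * (y - x).
Proof.
move=> r0 rv; apply: (@mx_norm_lipschitz _ _ _ (fun t => frame_rot r v ((t - m) / r))
  (fun t => frame_rot r v ((t - m) / r) *m frame_gen v)) => [|t|t].
- exact: mulr_ge0.
- exact: is_derive_frame_rot.
- rewrite (le_trans (mx_norm_mulmx _ _))// ler_wpM2l// ler_piMl//.
  exact/is_SO3_norm_le1/is_SO3_frame_rot.
Qed.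

Lemma two_arcs_controlled_path (R : realType) (r v phi1 phi2 : R)
    (g0 : 'M[R]_3) :
  0 < r -> r ^+ 2 * (1 + v ^+ 2) = 1 -> `|v| <= Umax r ->
  0 <= phi1 -> 0 <= phi2 -> is_SO3 g0 ->
  controlled_path r g0 (CC_length r phi1 phi2)
    (fun s => if s <= r * phi1 then v else - v)
    (two_arcs r v g0 (r * phi1)).
Proof.
move=> r0 rv vU phi10 phi20 g0SO; have rn0 : r != 0 by rewrite gt_eqF.
have rv' : r ^+ 2 * (1 + (- v) ^+ 2) = 1 by rewrite sqrrN.
have m0 : 0 <= r * phi1 by rewrite mulr_ge0// ltW.
rewrite /CC_length; set m := r * phi1; set L := m + _.
have mL : m <= L by rewrite lerDl mulr_ge0// ltW.
have aSO s : is_SO3 (g0 *m frame_rot r v (Num.min s m / r)).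
  exact/is_SO3_mul/is_SO3_frame_rot.
have bSO s : is_SO3 (frame_rot r (- v) ((Num.max s m - m) / r))
  by exact: is_SO3_frame_rot.
split.
- split; first exact: le_trans mL.
  by rewrite /two_arcs min_l// max_r// subrr !mul0r !frame_rot0 !mulmx1.
- by move=> s _; exact: is_SO3_mul.
- apply: is_SO3_mulmx_abs_continuous => //.
    apply: is_SO3_mulmx_abs_continuous => //.
    + by move=> s _; exact: is_SO3_frame_rot.
    + apply: (@lipschitz_abs_continuous _ _ _ _ 0) => x y _.
      by rewrite subrr normr0 mul0r.
    + apply: (@lipschitz_abs_continuous _ _ _ _ (3 * `|frame_gen v|)) => x y xy.
      have [mxy ?] : Num.min x m <= Num.min y m /\
          Num.min y m - Num.min x m <= y - x.
        by case: (leP x m) => ?; case: (leP y m) => ?; split; lra.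
      have /le_trans := frame_rot_lipschitz 0 rn0 rv mxy; rewrite !subr0; apply.
      by apply: ler_wpM2l => //; exact: mulr_ge0.
  apply: (@lipschitz_abs_continuous _ _ _ _ (3 * `|frame_gen (- v)|)) => x y xy.
  have [mxy ?] : Num.max x m <= Num.max y m /\
      Num.max y m - Num.max x m <= y - x.
    by case: (leP x m) => ?; case: (leP y m) => ?; split; lra.
  apply: le_trans (frame_rot_lipschitz m rn0 rv' mxy) _.
  by apply: ler_wpM2l => //; exact: mulr_ge0.
- have vv : - Umax r <= v <= Umax r by rewrite -ler_norml.
  split; last by move=> s _; case: ifP => // _; rewrite -ler_norml normrN.
  apply: measurable_funTS; apply: measurable_fun_ifT => //.
  exact: measurable_fun_ler.
(* The joint is the only exceptional point: the formula extends beyond [0] and the final length, so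
   two-sided derivatives exist there too. *)
exists [set m]%classic.
split; [exact: measurable_set1|exact: lebesgue_measure_set1|].
apply: subsetCl => s /= /eqP sm sL; apply/frame_derivP.
have [ms|ms] := leP s m.
  have {}ms : s < m by rewrite lt_neqAle sm.
  have dG := is_derive_mulmx (is_derive_cst g0 s 1)
    (is_derive_frame_rot 0 s rn0 rv).
  apply: near_eq_is_derive (is_derive_eq dG _).
    near=> t; have tm : t <= m by near: t; exact: lt_le_nbhsl.
    by rewrite /two_arcs min_l// max_r// subrr mul0r frame_rot0 mulmx1 subr0.
  rewrite /two_arcs min_l ?(ltW ms)// max_r ?(ltW ms)// subrr mul0r.
  by rewrite frame_rot0 mulmx1 mul0mx add0r mulmxA subr0.
have dG := is_derive_mulmx (is_derive_cst (g0 *m frame_rot r v (m / r)) s 1)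
  (is_derive_frame_rot m s rn0 rv').
apply: near_eq_is_derive (is_derive_eq dG _).
  near=> t; have tm : m <= t by near: t; exact: lt_le_nbhsr.
  by rewrite /two_arcs min_r// max_l.
rewrite /two_arcs min_r ?(ltW ms)// max_l ?(ltW ms)//.
by rewrite mul0mx add0r mulmxA.
Unshelve. all: by end_near.
Qed.

Lemma two_arcs_end (R : realType) (r v phi1 phi2 : R) (g0 : 'M[R]_3) :
  0 < r -> 0 <= phi2 ->
  two_arcs r v g0 (r * phi1) (CC_length r phi1 phi2) =
  g0 *m frame_rot r v phi1 *m frame_rot r (- v) phi2.
Proof.
move=> r0 phi20; have le1 : r * phi1 <= CC_length r phi1 phi2.
  by rewrite lerDl mulr_ge0// ltW.
rewrite /two_arcs min_r// max_l// /CC_length addrAC subrr add0r.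
by rewrite ![r * _]mulrC !mulfK// gt_eqF.
Qed.

(* Reflection in the plane through the final location and the axis of the first
   circle: [d] is the angle, seen from that axis, between the tangency point of
   the two circles and the final location. *)
Lemma frame_rot_reflect (R : realType) (r v beta d : R) :
  r ^+ 2 * (1 + v ^+ 2) = 1 ->
  (2 * (1 - r ^+ 2) + (1 - 2 * r ^+ 2) * cos beta) * sin d =
    sin beta * cos d ->
  col 0 (frame_rot r v (pi - 2 * d) *m frame_rot r (- v) (pi - beta)) =
  col 0 (frame_rot r v pi *m frame_rot r (- v) (pi + beta)).
Proof.
move=> rv dP.
(* Both paths begin with a rotation by [pi - d], which brings the frame to the plane of symmetry;
   what remains starts with opposite rotations by [- d] and [d]. *)
have -> : pi - 2 * d = (pi - d) + - d by ring.
have -> : frame_rot r v pi = frame_rot r v (pi - d) *m frame_rot r v d.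
  by rewrite -frame_rotD// subrK.
rewrite frame_rotD// -!mulmxA !colE -!mulmxA; congr (_ *m _).
rewrite !mulmxA -!colE.
have [sB cB] : sin (pi - beta) = sin beta /\ cos (pi - beta) = - cos beta.
  by rewrite sinB cosB sinpi cospi; split; ring.
have [sD cD] : sin (pi + beta) = - sin beta /\ cos (pi + beta) = - cos beta.
  by rewrite sinD cosD sinpi cospi; split; ring.
apply/matrixP => i j; rewrite !ord1 {j}.
rewrite /frame_rot sB cB sD cD sinN cosN.
have rv2 : r ^+ 2 * v ^+ 2 = 1 - r ^+ 2 by rewrite -rv; ring.
move: (sin beta) (cos beta) (sin d) (cos d) dP => sb cb s c dP.
(* The two columns are mirror images under a sign change of coordinate 1, so coordinates 0 and 2
   agree identically. Coordinate 1 must vanish, and this is what [dP] expresses, modulo [rv2]. *)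
case: i => [[|[|[|//]]] ip];
  rewrite !mxE !big_ord_recl !big_ord0 !mxE !big_ord_recl !big_ord0 !mxE /=;
  rewrite ?(mulr0, mul0r, addr0, add0r); [ring| |ring].
apply/eqP; rewrite -subr_eq0; apply/eqP.
transitivity (2 * r *
    (sb * c - (2 * (1 - r ^+ 2) + (1 - 2 * r ^+ 2) * cb) * s) -
    2 * r * (sb * (1 - c) + s * (1 + cb)) *
    (r ^+ 2 * v ^+ 2 - (1 - r ^+ 2))); first by ring.
by rewrite rv2 dP !subrr !mulr0 subrr.
Qed.

(** * The shorter path *)

Theorem lemma12 (R : realType) (r beta : R) (c : turn) (g0 : 'M[R]_3)
    (g : R -> 'M[R]_3) :
  0 < r -> r <= Num.sqrt 3 / 2 ->
  0 < beta -> beta < pi ->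
  is_SO3 g0 ->
  CC_path r g0 c pi (pi + beta) g ->
  exists (L' : R) (g' : R -> 'M[R]_3),
    [/\ admissible_path r g0 L' g',
        L' < CC_length r pi (pi + beta) &
        location (g' L') = location (g (CC_length r pi (pi + beta)))].
Proof.
move=> r0 r3 b0 bpi g0SO [u [gu u1 u2]].
have r34 : r ^+ 2 <= 3 / 4.
  have s3 : Num.sqrt 3 ^+ 2 = 3 :> R by rewrite sqr_sqrtr.
  have s0 : 0 <= Num.sqrt 3 :> R by exact: sqrtr_ge0.
  by nra.
set v := turn_control r c.
have U0 : 0 <= Umax r by rewrite /Umax divr_ge0 ?sqrtr_ge0// ltW.
have vU : `|v| = Umax r.
  by rewrite /v; case: c {u1 u2 v} => /=; rewrite ?normrN ger0_norm.
have rv : r ^+ 2 * (1 + v ^+ 2) = 1.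
  rewrite -(real_normK (num_real v)) vU /Umax expr_div_n sqr_sqrtr; last lra.
  by field; rewrite gt_eqF.
have oppv : turn_control r (opposite c) = - v.
  by rewrite /v; case: c {u1 u2 v vU rv} => //=; rewrite opprK.
have pi0 : 0 < pi :> R by exact: pi_gt0.
have sb0 : 0 < sin beta by apply: sin_gt0_pi; rewrite b0.
(* Strictness matters in the limit case [r ^+ 2 = 3 / 4], where [B] below equals
   [(1 - cos beta) / 2]. *)
have cb1 : cos beta < 1.
  by have := cos2Dsin2 beta; have := cos_le1 beta; nra.
pose B := 2 * (1 - r ^+ 2) + (1 - 2 * r ^+ 2) * cos beta.
(* [B] is affine in [r ^+ 2] and positive at both ends [0] and [3 / 4]. *)
have B0 : 0 < B by rewrite /B; have := cos_geN1 beta; nra.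
(* This solves the equation required by [frame_rot_reflect]; since [B] and [sin beta] are positive,
   [d] lies strictly between 0 and [pi / 2]. *)
pose d := atan (sin beta / B).
have dpi : d < pi / 2 by exact: atan_ltpi2.
have cd0 : 0 < cos d by apply: cos_gt0_pihalf; rewrite dpi atan_gtNpi2.
have dP : B * sin d = sin beta * cos d.
  have := atanK (sin beta / B); rewrite -/d /tan => /eqP.
  rewrite eqr_div ?lt0r_neq0// => /eqP dE.
  by rewrite mulrC dE.
have d0 : 0 < d.
  rewrite ltNge; apply/negP => d0.
  have : 0 <= sin (- d).
    apply: sin_ge0_pi; have := atan_gtNpi2 (sin beta / B); rewrite -/d; lra.
  by rewrite sinN; nra.
have gE : g (CC_length r pi (pi + beta)) =
    g0 *m frame_rot r v pi *m frame_rot r (- v) (pi + beta).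
  rewrite -two_arcs_end//; last by rewrite addr_ge0// ltW.
  have := @two_arcs_controlled_path _ r v pi (pi + beta) g0 r0 rv.
  rewrite vU lexx => /(_ isT (ltW pi0) _ g0SO) G.
  apply: controlled_path_uniq gu (G _) _; first by rewrite addr_ge0// ltW.
  set L := CC_length _ _ _.
  (* The control of the given path is prescribed only inside the two segments, so it may differ from
     the explicit one at these three points. *)
  pose D := [set 0; r * pi; L]%classic.
  have cD : countable D.
    apply: finite_set_countable; rewrite /D !finite_setU.
    by do !split; exact: finite_set1.
  exists D; split; first exact: countable_measurable.
    exact: countable_lebesgue_measure0.
  apply: subsetCl => s /= sD; rewrite in_itv/= => /andP[s0 sL].
  have sn x : x \in [:: 0; r * pi; L] -> s != x.
    rewrite !inE => /or3P[]/eqP ->; apply: contra_not_neq sD => ->;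
    by rewrite /D /=; tauto.
  have {}s0 : 0 < s by rewrite lt_neqAle s0 eq_sym sn// inE eqxx.
  have {}sL : s < L by rewrite lt_neqAle sL sn// !inE eqxx !orbT.
  have [sm|sm] := leP s (r * pi).
    by apply: u1; rewrite in_itv/= s0 add0r lt_neqAle sm sn// !inE eqxx orbT.
  by rewrite u2 ?oppv// in_itv/= sm.
exists (CC_length r (pi - 2 * d) (pi - beta)),
  (two_arcs r v g0 (r * (pi - 2 * d))); split.
- eexists; apply: two_arcs_controlled_path => //; rewrite ?vU//; lra.
(* The saving in length is [2 * r * (d + beta)]. *)
- rewrite /CC_length -!mulrDr ltr_pM2l//; lra.
- rewrite two_arcs_end//; last lra.
  rewrite gE /location -!mulmxA [LHS]colE [RHS]colE -[LHS]mulmxA -[RHS]mulmxA.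
  by rewrite -!colE frame_rot_reflect.
Qed.
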